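(* Let $n\ge 1$ and consider $\mathbb{C}^d=(\mathbb{C}^2)^{\otimes n}$, $d=2^n$. Up to local equivalence transformations there exists a unique triple of pairwise mutually unbiased product bases, namely $$\mathcal{B}_0=\{|j_z^1\rangle\otimes\cdots\otimes|j_z^n\rangle\},\quad \mathcal{B}_1=\{|j_x^1\rangle\otimes\cdots\otimes|j_x^n\rangle\},\quad \mathcal{B}_2=\{|j_y^1\rangle\otimes\cdots\otimes|j_y^n\rangle\},$$ where, for each $r=1,\ldots,n$ and $b\in\{z,x,y\}$, $\{|j_b^r\rangle : j=0,1\}$ is the orthonormal eigenbasis of the Pauli operator $\sigma_b$ on the $r$-th factor $\mathbb{C}^2$, and in each $\mathcal{B}_i$ the labels $j^1,\ldots,j^n\in\{0,1\}$ of the different factors vary independently.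
   Context: A product basis of $\mathbb{C}^{d_1}\otimes\cdots\otimes\mathbb{C}^{d_n}$ is an orthonormal basis each of whose vectors is a tensor product $|\psi^1\rangle\otimes\cdots\otimes|\psi^n\rangle$ with $|\psi^r\rangle\in\mathbb{C}^{d_r}$. It need not be a tensor product of bases of the factors. Two orthonormal bases $\{|a_i\rangle\}$, $\{|b_j\rangle\}$ of $\mathbb{C}^d$ are mutually unbiased if $|\langle a_i|b_j\rangle|^2=1/d$ for all $i,j$. Two sets of product bases are equivalent (under local equivalence transformations) if one is obtained from the other by a composition of the following: a local unitary $U_1\otimes\cdots\otimes U_n$ ($U_r$ unitary on $\mathbb{C}^{d_r}$) applied to all bases simultaneously; multiplication of any basis vector by a phase factor; permutation of the vectors within a basis; local complex conjugation applied to all bases (i.e. for a chosen factor $r$, replacing the $r$-th tensor factor of every vector of every basis by its entrywise complex conjugate in the standard basis); and reordering of the bases. *)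

(* Defs.v *)
From Stdlib Require Export Relation_Operators.
From mathcomp Require Export all_boot all_order perm all_algebra.
From mathcomp Require Export complex reals.

Set Implicit Arguments.
Unset Strict Implicit.
Unset Printing Implicit Defensive.

Import Order.TTheory GRing.Theory Num.Theory.
Local Open Scope ring_scope.
Local Open Scope sesquilinear_scope.

(* (C^2)^{(x) n} is realised as the space of functions on multi-indices
   k = (k^1, ..., k^n): the entry of v at k is the coordinate of v on
   |k^1> (x) ... (x) |k^n>, with |0>, |1> the standard basis of C^2. *)
Notation multi_index n := {ffun 'I_n -> 'I_2}.

Notation qubits R n := {ffun multi_index n -> R[i]}.

(* A candidate basis: d = 2^n vectors, labelled by the d multi-indices.  The
   labelling carries no meaning: it can be permuted by [step_permute]. *)
Definition vec_family (R : realType) (n : nat) : Type :=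
  multi_index n -> qubits R n.

Section ProductBases.
Variables (R : realType) (n : nat).

(* <u|v>, antilinear in the first argument. *)
Definition inner (u v : qubits R n) : R[i] :=
  \sum_(k : multi_index n) (u k)^* * v k.

Definition tensor (psi : 'I_n -> 'cV[R[i]]_2) : qubits R n :=
  [ffun k : multi_index n => \prod_(r < n) psi r (k r) 0].

(* The d-dimensional space has d labels, so orthonormality suffices for B to be
   a basis. *)
Definition orthonormal_basis (B : vec_family R n) : Prop :=
  forall j k, inner (B j) (B k) = (j == k)%:R.

Definition product_basis (B : vec_family R n) : Prop :=
  orthonormal_basis B /\ forall k, exists psi, B k = tensor psi.

Definition mutually_unbiased (A B : vec_family R n) : Prop :=
  forall j k, `|inner (A j) (B k)| ^+ 2 = ((2 ^ n)%N%:R)^-1.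

Definition MU_product_bases (m : nat) (T : 'I_m -> vec_family R n) : Prop :=
  (forall i, product_basis (T i)) /\
  (forall i j, i != j -> mutually_unbiased (T i) (T j)).

(* The operator U_1 (x) ... (x) U_n. *)
Definition local_op (U : 'I_n -> 'M[R[i]]_2) (v : qubits R n) : qubits R n :=
  [ffun k : multi_index n =>
     \sum_(l : multi_index n) (\prod_(r < n) U r (k r) (l r)) * v l].

Definition conj_factor (r : 'I_n) (psi : 'I_n -> 'cV[R[i]]_2) :
    'I_n -> 'cV[R[i]]_2 :=
  fun s => if s == r then map_mx Num.conj (psi s) else psi s.

(* In [step_conj] the factors of a unit product vector are only determined up to
   scalars, so the conjugated vector is determined up to a phase; a different
   choice of factors amounts to a further [step_phase]. *)
Inductive local_step (m : nat) (T T' : 'I_m -> vec_family R n) : Prop :=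
| step_unitary (U : 'I_n -> 'M[R[i]]_2) of
    (forall r, U r \is unitarymx) &
    (forall i k, T' i k = local_op U (T i k))
| step_phase (c : 'I_m -> multi_index n -> R[i]) of
    (forall i k, `|c i k| = 1) &
    (forall i k, T' i k = [ffun l => c i k * T i k l])
| step_permute (s : 'I_m -> {perm multi_index n}) of
    (forall i k, T' i k = T i (s i k))
| step_conj (r : 'I_n) of
    (forall i k, exists psi,
       T i k = tensor psi /\ T' i k = tensor (conj_factor r psi))
| step_reorder (s : {perm 'I_m}) of
    (forall i k, T' i k = T (s i) k).

(* Every step is inverted by a step of the same kind, so this is an equivalence
   relation on families of product bases. *)
Definition locally_equivalent (m : nat) :
    ('I_m -> vec_family R n) -> ('I_m -> vec_family R n) -> Prop :=
  clos_refl_trans _ (@local_step m).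

End ProductBases.

Section Pauli.
Variable R : realType.

Definition sigma_z : 'M[R[i]]_2 :=
  \matrix_(s, t) (if s == t then (-1) ^+ s else 0).

Definition sigma_x : 'M[R[i]]_2 := \matrix_(s, t) (s != t)%:R.

(* sigma_y = [[0, -i], [i, 0]] *)
Definition sigma_y : 'M[R[i]]_2 :=
  \matrix_(s, t) (if s == t then 0 else if s == 0 then - 'i%C else 'i%C).

Definition orthonormal_eigenbasis (A : 'M[R[i]]_2) (e : 'I_2 -> 'cV[R[i]]_2) :
    Prop :=
  (forall j k, (e j)^t* *m e k = ((j == k)%:R)%:M) /\
  (forall j, exists a : R[i], A *m e j = a *: e j).

(* Labels 0, 1, 2 stand for z, x, y, matching B_0, B_1, B_2. *)
Definition pauli (b : 'I_3) : 'M[R[i]]_2 :=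
  tnth [tuple sigma_z; sigma_x; sigma_y] b.

(* e b r j is the vector |j_b^r>.  An orthonormal eigenbasis of a Pauli operator
   is unique up to phases and the order of its two vectors, so the choice is a
   parameter. *)
Definition pauli_eigenbases (n : nat)
    (e : 'I_3 -> 'I_n -> 'I_2 -> 'cV[R[i]]_2) : Prop :=
  forall b r, orthonormal_eigenbasis (pauli b) (e b r).

Definition pauli_triple (n : nat) (e : 'I_3 -> 'I_n -> 'I_2 -> 'cV[R[i]]_2) :
    'I_3 -> vec_family R n :=
  fun b j => tensor (fun r => e b r (j r)).

End Pauli.

(* Main.v *)
(* If a unit product vector v is unbiased to a product basis (psi_k), write
   q_{k,r} = |<psi_k^r|v^r>|^-2.  Then the product of q_{k,r} over r is 2^n, while
   Parseval's identity for v with its r-th factor replaced by a standard basis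
   vector shows that q_{k,r} averages to 2 over k.  By AM-GM every q_{k,r} is 2, so
   unbiasedness holds factor by factor.  On each qubit the factors of the three
   bases then lie on three mutually orthogonal axes of the Bloch sphere, which a
   unitary takes to the z, x and y axes; complex conjugation is not needed, since
   the two vectors on an axis may be exchanged. *)
Require Import Defs.
From mathcomp Require Import ring.

Set Implicit Arguments.
Unset Strict Implicit.
Unset Printing Implicit Defensive.

Import Order.TTheory GRing.Theory Num.Theory.
Local Open Scope ring_scope.
Local Open Scope sesquilinear_scope.

(** * Inner products and rays in a single qubit *)

Section Qubit.
Variable C : numClosedFieldType.
Implicit Types u v w : 'cV[C]_2.

Lemma conjM (x y : C) : (x * y)^* = x^* * y^*.
Proof. exact: rmorphM. Qed.

Lemma conjD (x y : C) : (x + y)^* = x^* + y^*.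
Proof. exact: rmorphD. Qed.

Definition dot u v : C := (u 0 0)^* * v 0 0 + (u 1 0)^* * v 1 0.

Definition unbiased u v := `|dot u v| ^+ 2 = 2^-1.

(** Equality up to a phase: for unit vectors, the same point of the Bloch sphere. *)
Definition same_ray u v := exists2 c : C, `|c| = 1 & u = c *: v.

Lemma ord2P (P : 'I_2 -> Prop) : P 0 -> P 1 -> forall j, P j.
Proof.
move=> P0 P1 [[|[|j]] lt_j2] //.
- by rewrite (_ : Ordinal _ = 0) //; apply/val_inj.
- by rewrite (_ : Ordinal _ = 1) //; apply/val_inj.
Qed.

Lemma ord3P (P : 'I_3 -> Prop) : P 0 -> P 1 -> P 2 -> forall j, P j.
Proof.
move=> P0 P1 P2 [[|[|[|j]]] lt_j3] //.
- by rewrite (_ : Ordinal _ = 0) //; apply/val_inj.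
- by rewrite (_ : Ordinal _ = 1) //; apply/val_inj.
- by rewrite (_ : Ordinal _ = 2) //; apply/val_inj.
Qed.

Lemma sum_ord2 (F : 'I_2 -> C) : \sum_(j < 2) F j = F 0 + F 1.
Proof. by rewrite big_ord_recl big_ord1; congr (_ + F _); apply/val_inj. Qed.

Lemma cV2P u v : u 0 0 = v 0 0 -> u 1 0 = v 1 0 -> u = v.
Proof.
by move=> uv0 uv1; apply/colP=> t; move: t; apply: ord2P.
Qed.

Lemma dot_mx u v : u^t* *m v = (dot u v)%:M.
Proof.
by apply/matrixP=> s t; rewrite !ord1 !mxE sum_ord2 !mxE mulr1n.
Qed.

Lemma dotZ c d u v : dot (c *: u) (d *: v) = c^* * d * dot u v.
Proof. rewrite /dot !mxE !conjM; ring. Qed.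

Lemma dot_unitary (U : 'M[C]_2) u v :
  U \is unitarymx -> dot (U *m u) (U *m v) = dot u v.
Proof.
move=> /unitarymxP/mulmx1C UU.
have: (U *m u)^t* *m (U *m v) = u^t* *m v.
  by rewrite trmx_mul map_mxM mulmxA -(mulmxA _ _ U) UU mulmx1.
by rewrite !dot_mx => /matrixP/(_ 0 0); rewrite !mxE !mulr1n.
Qed.

Lemma unbiased_ray u u' v v' :
  same_ray u u' -> same_ray v v' -> unbiased u v <-> unbiased u' v'.
Proof.
case=> c c1 -> [d d1 ->].
by rewrite /unbiased dotZ !normrM norm_conjC c1 d1 !mul1r.
Qed.

Lemma same_ray_dot u v : dot v v = 1 -> same_ray u v ->
  `|dot v u| = 1 /\ u = dot v u *: v.
Proof.
move=> v1 [c c1 ->]; rewrite -[v in dot v]scale1r dotZ v1.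
by rewrite conjC1 mul1r mulr1.
Qed.

Lemma same_ray_refl u : same_ray u u.
Proof. by exists 1; rewrite ?normr1 ?scale1r. Qed.

Lemma same_ray_sym u v : same_ray u v -> same_ray v u.
Proof.
case=> c c1 ->; exists c^-1; first by rewrite normfV c1 invr1.
by rewrite scalerA mulVf ?scale1r // -normr_eq0 c1 oner_eq0.
Qed.

Lemma same_ray_trans u v w : same_ray u v -> same_ray v w -> same_ray u w.
Proof.
case=> c c1 -> [d d1 ->]; exists (c * d); last by rewrite scalerA.
by rewrite normrM c1 d1 mulr1.
Qed.

(** * Pauli eigenvectors and Bloch coordinates *)

Definition inv_sqrt2 : C := sqrtC 2^-1.

Lemma inv_sqrt2E : inv_sqrt2 * inv_sqrt2 = 2^-1.
Proof. by rewrite -expr2 sqrtCK. Qed.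

Lemma conj_inv_sqrt2 : inv_sqrt2^* = inv_sqrt2.
Proof. by apply/CrealP; rewrite ger0_real // sqrtC_ge0 invr_ge0 ler0n. Qed.

Lemma inv_sqrt2_neq0 : inv_sqrt2 != 0.
Proof. by rewrite sqrtC_eq0 invr_eq0 pnatr_eq0. Qed.

(** The standard unit eigenvector of the Pauli operator on axis b (0, 1, 2 for z, x, y) with
    eigenvalue (-1)^j. *)
Definition pauli_vec (b : 'I_3) (j : 'I_2) : 'cV[C]_2 :=
  \col_t tnth [tuple (t == j)%:R;
                     inv_sqrt2 * (if t == 0 then 1 else (-1) ^+ j);
                     inv_sqrt2 * (if t == 0 then 1 else (-1) ^+ j * 'i)] b.

Lemma pauli_vecE :
  (forall j, (pauli_vec 0 j 0 0 = (0 == j)%:R) *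
    (pauli_vec 0 j 1 0 = (1 == j)%:R)) *
  (forall j, (pauli_vec 1 j 0 0 = inv_sqrt2) *
    (pauli_vec 1 j 1 0 = inv_sqrt2 * (-1) ^+ j)) *
  (forall j, (pauli_vec 2 j 0 0 = inv_sqrt2) *
    (pauli_vec 2 j 1 0 = inv_sqrt2 * ((-1) ^+ j * 'i))).
Proof. by do !split; rewrite mxE /tnth /= ?mulr1. Qed.

Lemma pauli_vec_ortho b j k : dot (pauli_vec b j) (pauli_vec b k) = (j == k)%:R.
Proof.
have i2 : 'i * 'i = -1 :> C by rewrite -expr2 sqrCi.
have h2 : 2 * 2^-1 = 1 :> C by rewrite divff // pnatr_eq0.
move: b j k; apply: ord3P; apply: ord2P; apply: ord2P;
  rewrite /dot !pauli_vecE /= ?expr0 ?expr1 ?conjM ?conj_inv_sqrt2 ?conjCi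
    ?rmorphN ?rmorph1 ?rmorph0.
all: by ring: inv_sqrt2E i2 h2.
Qed.

(** The expectation value <v|sigma_b|v>, that is, the coordinate of the Bloch vector of v along axis
    b. *)
Definition bloch (b : 'I_3) v : C :=
  tnth [tuple v 0 0 * (v 0 0)^* - v 1 0 * (v 1 0)^*;
              v 0 0 * (v 1 0)^* + (v 0 0)^* * v 1 0;
              'i * (v 0 0 * (v 1 0)^* - (v 0 0)^* * v 1 0)] b.

(** The projector onto [pauli_vec b j] is (1 + (-1)^j sigma_b) / 2. Hence unbiasedness to an axis
    becomes a linear condition on the Bloch vector. *)
Lemma sqr_norm_dot_pauli b j v :
  `|dot (pauli_vec b j) v| ^+ 2 = 2^-1 * (dot v v + (-1) ^+ j * bloch b v).
Proof.
have i2 : 'i * 'i = -1 :> C by rewrite -expr2 sqrCi.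
have h2 : 2 * 2^-1 = 1 :> C by rewrite divff // pnatr_eq0.
rewrite normCK /bloch; move: b j; apply: ord3P; apply: ord2P;
  rewrite /dot !pauli_vecE /tnth /= ?expr0 ?expr1 !(conjM, conjD, conjCK)
    ?conj_inv_sqrt2 ?conjCi ?rmorphN ?rmorph1 ?rmorph0 /= ?conj_inv_sqrt2.
all: by ring: inv_sqrt2E i2 h2.
Qed.

Lemma unbiased_pauli b j v :
  dot v v = 1 -> unbiased (pauli_vec b j) v <-> bloch b v = 0.
Proof.
move=> v1; rewrite /unbiased sqr_norm_dot_pauli v1; split=> [|->]; last first.
  by rewrite mulr0 addr0 mulr1.
rewrite -[RHS]mulr1 => /mulfI; rewrite invr_eq0 pnatr_eq0 => /(_ isT).
move/(canRL (addKr _)); rewrite addNr => /eqP.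
by rewrite mulf_eq0 signr_eq0 => /eqP.
Qed.

Lemma scale_same_ray c u v :
  dot u u = 1 -> dot v v = 1 -> v = c *: u -> same_ray v u.
Proof.
move=> u1 v1 vE; exists c => //; move: v1; rewrite vE dotZ u1 mulr1 mulrC.
by rewrite -normCK => /eqP; rewrite pexpr_eq1 // => /eqP.
Qed.

(** With p, q the entries of v, the vanishing of the other two coordinates forces p^* q = 0 on the z
    axis, q^2 = p^2 on the x axis and q^2 = - p^2 on the y axis. The two factors of each equation
    are the two ends of the axis. *)
Lemma same_ray_pauli c v : dot v v = 1 ->
  (forall b, b != c -> bloch b v = 0) -> exists j, same_ray v (pauli_vec c j).
Proof.
move=> v1 v_bloch.
have i2 : 'i * 'i = -1 :> C by rewrite -expr2 sqrCi.
suff [j [d vE]] : exists j d, v = d *: pauli_vec c j.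
  by exists j; apply: scale_same_ray vE => //; rewrite pauli_vec_ortho eqxx.
move: v1 v_bloch; rewrite /dot /bloch.
set p : C := v 0 0; set q : C := v 1 0 => v1.
move: c; apply: ord3P => v_bloch.
- have X : p * q^* + p^* * q = 0 := v_bloch 1 isT.
  have Y : 'i * (p * q^* - p^* * q) = 0 := v_bloch 2 isT.
  have /eqP : 2 * (p^* * q) = 0.
    transitivity ((p * q^* + p^* * q) + 'i * ('i * (p * q^* - p^* * q))).
      by ring: i2.
    by rewrite X Y mulr0 addr0.
  rewrite !mulf_eq0 pnatr_eq0 conjC_eq0 /= => /orP[/eqP p0|/eqP q0].
    exists 1, q; apply: cV2P; rewrite mxE !pauli_vecE /= -/p -/q ?p0; ring.
  by exists 0, p; apply: cV2P; rewrite mxE !pauli_vecE /= -/p -/q ?q0; ring.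
- have Z : p * p^* - q * q^* = 0 := v_bloch 0 isT.
  have Y : 'i * (p * q^* - p^* * q) = 0 := v_bloch 2 isT.
  have /eqP : (q - p) * (q + p) = 0.
    (* The factor |p|^2 + |q|^2 = 1 puts q^2 - p^2 into the ideal of Y and Z. *)
    rewrite -[LHS]mulr1 -v1.
    transitivity (2 * p * q * 'i * ('i * (p * q^* - p^* * q)) -
                  (q ^+ 2 + p ^+ 2) * (p * p^* - q * q^*)); first by ring: i2.
    by rewrite Y Z !mulr0 subr0.
  (* The scalar is fixed by the first entry, which is [inv_sqrt2] in both x eigenvectors. *)
  rewrite mulf_eq0 subr_eq0 addr_eq0 => /orP[]/eqP qE; [exists 0|exists 1];
    exists (p / inv_sqrt2); apply: cV2P; rewrite mxE !pauli_vecE /= -/p -/q ?qE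
      ?expr0 ?expr1; field; exact: inv_sqrt2_neq0.
- have Z : p * p^* - q * q^* = 0 := v_bloch 0 isT.
  have X : p * q^* + p^* * q = 0 := v_bloch 1 isT.
  (* As for the x axis, the factor |p|^2 + |q|^2 = 1 puts q^2 + p^2 into the ideal of X and Z. *)
  have /eqP : (q - 'i * p) * (q + 'i * p) = 0.
    rewrite -[LHS]mulr1 -v1.
    transitivity (2 * p * q * (p * q^* + p^* * q) +
                  (p ^+ 2 - q ^+ 2) * (p * p^* - q * q^*)); first by ring: i2.
    by rewrite X Z !mulr0 addr0.
  rewrite mulf_eq0 subr_eq0 addr_eq0 => /orP[]/eqP qE; [exists 0|exists 1];
    exists (p / inv_sqrt2); apply: cV2P; rewrite mxE !pauli_vecE /= -/p -/q ?qE
      ?expr0 ?expr1; field; exact: inv_sqrt2_neq0.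
Qed.

Lemma bloch_pauli_vec b c j : b != c -> bloch b (pauli_vec c j) = 0.
Proof.
have i2 : 'i * 'i = -1 :> C by rewrite -expr2 sqrCi.
move: b c j; apply: ord3P; apply: ord3P => //; apply: ord2P => _;
  rewrite /bloch /tnth /= !pauli_vecE /= ?expr0 ?expr1 ?mul1r ?mulN1r
    ?conjM ?conj_inv_sqrt2 ?rmorphN ?conjCi ?rmorph1 ?rmorph0 /= ?conjCi;
  by ring: i2.
Qed.

Lemma unbiased_pauli_vec b c j k :
  b != c -> unbiased (pauli_vec b j) (pauli_vec c k).
Proof.
move=> bc; apply/unbiased_pauli; first by rewrite pauli_vec_ortho eqxx.
exact: bloch_pauli_vec.
Qed.

(** The rows of U are the adjoint of a and a covector vanishing on a. This sends a to the z axis and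
    leaves the phase w of the second row free to bring b onto the x axis. *)
Lemma unitary_to_pauli a b : dot a a = 1 -> dot b b = 1 -> unbiased a b ->
  exists2 U : 'M[C]_2, U \is unitarymx &
    same_ray (U *m a) (pauli_vec 0 0) /\ same_ray (U *m b) (pauli_vec 1 0).
Proof.
move=> a1 b1; rewrite /unbiased normCK; set s := dot a b => s2.
pose t := a 0 0 * b 1 0 - a 1 0 * b 0 0.
(* Lagrange's identity: |s|^2 + |t|^2 = |a|^2 |b|^2 = 1. *)
have t2 : t * t^* = 2^-1.
  have <- : 1 - 2^-1 = 2^-1 :> C by field.
  rewrite -s2 -[X in X - _]mulr1 -{1}a1 -b1 /s /t /dot.
  by rewrite !(conjM, conjD, conjCK, rmorphN) /= !conjM; ring.
have t0 : t != 0.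
  by apply: contra_eq_neq t2 => ->; rewrite mul0r eq_sym invr_eq0 pnatr_eq0.
(* The entries of [U *m b] are s and w t; this w makes them equal, and it is a phase because |s| =
   |t|. *)
pose w := s / t.
have w1 : w * w^* = 1.
  by rewrite /w conjM fmorphV mulrACA s2 -invfM t2 invrK mulVf ?pnatr_eq0.
pose U : 'M[C]_2 := \matrix_(i, j) (if i == 0 then (a j 0)^*
                                    else w * (if j == 0 then - a 1 0 else a 0 0)).
have Ua : U *m a = pauli_vec 0 0.
  apply: cV2P; rewrite !pauli_vecE mxE sum_ord2 !mxE /=; first exact: a1.
  by ring.
have Ub : U *m b = (s / inv_sqrt2) *: pauli_vec 1 0.
  apply: cV2P; rewrite [RHS]mxE !pauli_vecE mxE sum_ord2 !mxE /=.
    by rewrite -/(dot a b) -/s ?expr0; field; exact: inv_sqrt2_neq0.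
  rewrite expr0 -[RHS]/(s / inv_sqrt2 * (inv_sqrt2 * 1)) /w mulr1.
  rewrite divfK ?inv_sqrt2_neq0 //.
  by rewrite -[RHS](divfK t0) /t; ring.
have U1 : U \is unitarymx.
  apply/unitarymxP/matrixP; apply: ord2P; apply: ord2P;
    rewrite !mxE sum_ord2 !mxE /= ?conjM ?conjCK.
  - by rewrite mulr1n -a1.
  - by rewrite rmorphN /= mulr0n; ring.
  - by rewrite mulr0n; ring.
  - rewrite rmorphN /= mulr1n -[RHS]w1 -[RHS]mulr1 -a1 /dot conjM; ring.
exists U => //; split; first by exists 1; rewrite ?normr1 ?scale1r.
by apply: scale_same_ray Ub; rewrite ?pauli_vec_ortho // dot_unitary.
Qed.

End Qubit.

(** * Eigenvectors of the Pauli operators *)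

Section PauliEigen.
Variable R : realType.
Local Notation C := R[i].
Implicit Types v : 'cV[C]_2.

Lemma pauli_vec_eigen b j :
  exists a : C, pauli R b *m pauli_vec C b j = a *: pauli_vec C b j.
Proof.
have i2 : 'i * 'i = -1 :> C by rewrite -expr2 sqrCi.
exists ((-1) ^+ j); move: b j; apply: ord3P; apply: ord2P; apply: cV2P.
all: rewrite /pauli /tnth /= [LHS]mxE sum_ord2 [RHS]mxE !pauli_vecE !mxE /=
  ?complexiE ?expr0 ?expr1; ring: i2.
Qed.

Lemma pauli_vec_eigenbasis b : orthonormal_eigenbasis (pauli R b) (pauli_vec C b).
Proof.
by split=> [j k|j]; [rewrite dot_mx pauli_vec_ortho | exact: pauli_vec_eigen].
Qed.

Lemma pauli_mulE v :
  ((pauli R 0 *m v) 0 0 = v 0 0) * ((pauli R 0 *m v) 1 0 = - v 1 0) *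
  ((pauli R 1 *m v) 0 0 = v 1 0) * ((pauli R 1 *m v) 1 0 = v 0 0) *
  ((pauli R 2 *m v) 0 0 = - 'i * v 1 0) * ((pauli R 2 *m v) 1 0 = 'i * v 0 0).
Proof.
by do !split; rewrite mxE sum_ord2 /pauli /tnth !mxE /= ?complexiE; ring.
Qed.

Lemma pauli_invol b v : pauli R b *m (pauli R b *m v) = v.
Proof.
have i2 : 'i * 'i = -1 :> C by rewrite -expr2 sqrCi.
by move: b; apply: ord3P; apply: cV2P; rewrite !pauli_mulE; ring: i2.
Qed.

(** A Pauli operator squares to the identity, so a is 1 or -1; the eigenvector equations then make
    the Bloch coordinates along the other two axes vanish. *)
Lemma eigen_same_ray_pauli c a v : dot v v = 1 -> pauli R c *m v = a *: v ->
  exists j, same_ray v (pauli_vec C c j).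
Proof.
have i2 : 'i * 'i = -1 :> C by rewrite -expr2 sqrCi.
move=> v1 cv; apply: same_ray_pauli => // b bc.
have v0 : v != 0.
  by apply: contra_eq_neq v1 => ->; rewrite /dot !mxE !mulr0 addr0 eq_sym oner_eq0.
have a2 : a ^+ 2 == 1.
  have /eqP := pauli_invol c v; rewrite cv -scalemxAr cv scalerA -expr2.
  by rewrite -subr_eq0 -{2}[v]scale1r -scalerBl scaler_eq0 (negPf v0) orbF subr_eq0.
have [cv0 cv1] : (pauli R c *m v) 0 0 = a * v 0 0 /\
                 (pauli R c *m v) 1 0 = a * v 1 0 by rewrite cv !mxE.
have half0 (x : C) : x = - x -> x = 0.
  by move/eqP; rewrite -addr_eq0 -mulr2n mulrn_eq0 /= => /eqP.
rewrite sqrf_eq1 in a2; move: a2 b c bc cv0 cv1 {cv v1 v0}.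
(* Two signs and six ordered pairs of distinct axes give twelve cases. For c = 0 an entry of v
   equals its own negative; otherwise one entry is expressed by the other. *)
case/orP=> /eqP->; apply: ord3P; apply: ord3P => // _;
  rewrite !pauli_mulE /bloch /tnth /= ?mul1r ?mulN1r.
- by move=> -> _; ring.
- by move=> _ <-; rewrite conjM conjCi; ring: i2.
- by move=> _ /esym/half0->; rewrite conjC0; ring.
- by move=> _ <-; rewrite conjM conjCi; ring: i2.
- by move=> _ /esym/half0->; rewrite conjC0; ring.
- by move=> -> _; ring.
- by move=> -> _; rewrite rmorphN /=; ring.
- by move=> _ /(canLR (@opprK C)) <-; rewrite rmorphN /= conjM conjCi; ring: i2.
- by move=> /half0-> _; rewrite conjC0; ring.
- by move=> _ /(canLR (@opprK C)) <-; rewrite rmorphN /= conjM conjCi; ring: i2.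
- by move=> /half0-> _; rewrite conjC0; ring.
- by move=> -> _; rewrite rmorphN /=; ring.
Qed.

End PauliEigen.

(* Each arithmetic mean is at least the geometric mean x, and on average they
   equal x; so AM-GM is an equality for every i. *)
Lemma mean_eq_geometric_mean (F : numFieldType) (I J : finType)
    (q : I -> J -> F) (x : F) : 0 <= x ->
    (forall i j, 0 <= q i j) -> (forall i, \prod_j q i j = x ^+ #|J|) ->
    (forall j, \sum_i q i j = x *+ #|I|) ->
  forall i j, q i j = x.
Proof.
move=> x0 q0 prod_q sum_q i0 j0.
have J0 : (0 < #|J|)%N by apply/card_gt0P; exists j0.
have nJ0 : #|J|%:R != 0 :> F by rewrite pnatr_eq0 -lt0n.
pose mu i := (\sum_j q i j) / #|J|%:R.
have mu0 i : 0 <= mu i by rewrite divr_ge0 ?sumr_ge0.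
have AGM i := leif_AGM (fun j (_ : j \in predT) => q0 i j).
have le_mu i : x <= mu i.
  rewrite -(ler_pXn2r J0) ?nnegrE //.
  by have [] := AGM i; rewrite [X in X <= _ -> _]prod_q.
have mu_eq i : mu i = x.
  apply/eqP; rewrite -subr_eq0; apply/eqP; move: i isT.
  apply: psumr_eq0P => [i _|]; first by rewrite subr_ge0.
  rewrite sumrB sumr_const -mulr_suml exchange_big /=.
  under eq_bigr do rewrite sum_q.
  by rewrite sumr_const -[x *+ _ *+ _]mulr_natr mulfK ?subrr.
have prodE : \prod_j q i0 j = mu i0 ^+ #|J| by rewrite prod_q mu_eq.
have /forallP q_eq : [forall j in predT, forall k in predT, q i0 j == q i0 k].
  by have [_ <-] := AGM i0; exact/eqP/prodE.
rewrite -(mu_eq i0) /mu -[LHS](mulfK nJ0) mulr_natr -sumr_const; congr (_ / _).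
by apply: eq_bigr => j _; have /forallP/(_ j)/eqP := q_eq j0.
Qed.

(** * Product vectors, Parseval's identity and unbiasedness of factors *)

Section ProductVectors.
Variables (R : realType) (n : nat).
Local Notation C := R[i].
Implicit Types a b v : 'I_n -> 'cV[C]_2.

Lemma inner_tensor a b :
  inner (tensor a) (tensor b) = \prod_(r < n) dot (a r) (b r).
Proof.
transitivity (\prod_(r < n) \sum_(t < 2) (a r t 0)^* * b r t 0); last first.
  by apply: eq_bigr => r _; rewrite sum_ord2.
rewrite bigA_distr_bigA; apply: eq_bigr => k _ /=.
by rewrite !ffunE big_split rmorph_prod.
Qed.

Lemma local_op_tensor (U : 'I_n -> 'M[C]_2) a :
  local_op U (tensor a) = tensor (fun r => U r *m a r).
Proof.
apply/ffunP=> k; rewrite !ffunE.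
transitivity (\prod_(r < n) \sum_(t < 2) U r (k r) t * a r t 0); last first.
  by apply: eq_bigr => r _; rewrite mxE.
rewrite bigA_distr_bigA; apply: eq_bigr => l _ /=.
by rewrite ffunE big_split.
Qed.

Lemma tensorZ (c : 'I_n -> C) a :
  tensor (fun r => c r *: a r) = [ffun l => (\prod_(r < n) c r) * tensor a l].
Proof.
apply/ffunP=> k; rewrite !ffunE -big_split.
by apply: eq_bigr => r _; rewrite mxE.
Qed.

(** The matrix with rows [B k] is square, so the one-sided inverse given by orthonormality is
    two-sided; this is the completeness relation from which the identity follows. *)
Lemma parseval (B : vec_family R n) (w : qubits R n) : orthonormal_basis B ->
  \sum_k `|inner (B k) w| ^+ 2 = inner w w.
Proof.
move=> onB.
have complete l l' : \sum_k B k l * (B k l')^* = (l == l')%:R.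
  pose M : 'M[C]_#|{: multi_index n}| :=
    \matrix_(i, j) B (enum_val i) (enum_val j).
  have : map_mx Num.conj M *m M^T = 1%:M.
    apply/matrixP=> i j; rewrite !mxE -(inj_eq enum_val_inj) -onB /inner.
    rewrite (reindex_onto (enum_val : 'I_#|{: multi_index n}| -> _) enum_rank) /=;
      last by move=> ? _; rewrite enum_rankK.
    apply: eq_big => [k|k _]; first by rewrite enum_valK eqxx.
    by rewrite !mxE.
  move/mulmx1C/matrixP/(_ (enum_rank l) (enum_rank l')).
  rewrite !mxE (inj_eq enum_rank_inj) => <-.
  rewrite (reindex_onto (enum_val : 'I_#|{: multi_index n}| -> _) enum_rank) /=;
    last by move=> ? _; rewrite enum_rankK.
  apply: eq_big => [k|k _]; first by rewrite enum_valK eqxx.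
  by rewrite !mxE !enum_rankK.
transitivity (\sum_l \sum_l' (\sum_k B k l' * (B k l)^*) * (w l * (w l')^*)).
  under eq_bigr do rewrite normCK /inner rmorph_sum big_distrlr /=.
  rewrite exchange_big; apply: eq_bigr => l _; rewrite exchange_big /=.
  apply: eq_bigr => l' _; rewrite mulr_suml; apply: eq_bigr => k _.
  by rewrite conjM conjCK; ring.
apply: eq_bigr => l _; rewrite (bigD1 l) //= [X in _ + X]big1 ?addr0 => [|l' l'l].
  by rewrite complete eqxx mul1r mulrC.
by rewrite complete (negPf l'l) mul0r.
Qed.

Lemma card_multi_index : #|{: multi_index n}| = (2 ^ n)%N.
Proof. by rewrite card_ffun !card_ord. Qed.

Lemma unbiased_factors (B : vec_family R n)
    (psi : multi_index n -> 'I_n -> 'cV[C]_2) v :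
    orthonormal_basis B -> (forall k, B k = tensor (psi k)) ->
    (forall k r, dot (psi k r) (psi k r) = 1) -> (forall r, dot (v r) (v r) = 1) ->
    (forall k, `|inner (B k) (tensor v)| ^+ 2 = ((2 ^ n)%N%:R)^-1) ->
  forall k r, unbiased (psi k r) (v r).
Proof.
move=> onB BE psi1 v1 Bv.
pose p k r := `|dot (psi k r) (v r)| ^+ 2.
have prod_p k : \prod_r p k r = ((2 ^ n)%N%:R)^-1.
  by rewrite -(Bv k) BE inner_tensor normr_prod prodrXl.
have N0 : (2 ^ n)%N%:R != 0 :> C by rewrite pnatr_eq0 expn_eq0.
have p0 k r : p k r != 0.
  have : \prod_r p k r != 0 by rewrite prod_p invr_eq0.
  by move/prodf_neq0/(_ r isT).
pose q k r := (p k r)^-1.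
have q_ge0 k r : 0 <= q k r by rewrite invr_ge0 exprn_ge0.
have prod_q k : \prod_r q k r = 2 ^+ n.
  by rewrite prodfV prod_p invrK natrX.
have sum_q r : \sum_k q k r = 2 * (2 ^ n)%N%:R.
  pose e t r' : 'cV[C]_2 := if r' == r then delta_mx t 0 else v r'.
  have e1 t : inner (tensor (e t)) (tensor (e t)) = 1.
    rewrite inner_tensor big1 // => r' _; rewrite /e; case: ifP => // _.
    by move: t; apply: ord2P; rewrite /dot !mxE /= !(rmorph1, rmorph0); ring.
  (* Exchanging the factor r of v divides the constant product 2^-n by [p k r]; this is why AM-GM is
     applied to the inverses q. *)
  have normBe k t : `|inner (B k) (tensor (e t))| ^+ 2 =
      ((2 ^ n)%N%:R)^-1 * q k r * `|psi k r t 0| ^+ 2.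
    rewrite -(prod_p k) BE inner_tensor normr_prod -prodrXl.
    rewrite (bigD1 r) //= [in RHS](bigD1 r) //=.
    have -> : `|dot (psi k r) (e t r)| ^+ 2 = `|psi k r t 0| ^+ 2.
      rewrite /e eqxx -[in RHS]norm_conjC; congr (`|_| ^+ 2).
      by move: t; apply: ord2P; rewrite /dot !mxE /= ?(mulr1, mulr0) ?addr0 ?add0r.
    rewrite [RHS]mulrC; congr (_ * _); rewrite mulrAC mulfV // mul1r.
    by apply: eq_bigr => r' /negPf r'r; rewrite /e r'r.
  (* Parseval gives 1 for each of the two t. Summing over t first instead uses that [psi k r] is a
     unit vector and leaves 2^-n times the sum of q. *)
  have : \sum_t \sum_k `|inner (B k) (tensor (e t))| ^+ 2 = 2.
    by under eq_bigr do rewrite parseval // e1; rewrite sum_ord2.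
  rewrite exchange_big /=.
  under eq_bigr => k _.
    under eq_bigr do rewrite normBe.
    rewrite -mulr_sumr sum_ord2 !normCK.
    rewrite (_ : _ + _ = 1) ?mulr1; last by rewrite -(psi1 k r) /dot; ring.
    over.
  by rewrite -mulr_sumr => /(canRL (mulKf _)) ->; rewrite ?invr_eq0 // invrK mulrC.
move=> k0 r0.
suff q2 : q k0 r0 = 2 by rewrite /unbiased -q2 invrK.
apply: mean_eq_geometric_mean => // [k|r]; first by rewrite card_ord.
by rewrite sum_q card_multi_index mulr_natr.
Qed.

Lemma prod_nat_eq (j k : multi_index n) :
  \prod_(r < n) (j r == k r)%:R = (j == k)%:R :> C.
Proof.
have [->|jk] := eqVneq j k; first by rewrite big1 // => r _; rewrite eqxx.
apply/eqP; rewrite prodf_seq_eq0; apply: contra_neqT jk => jk.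
apply/ffunP=> r; apply/eqP; move: jk => /hasPn/(_ r).
by rewrite mem_index_enum pnatr_eq0 eqb0 negbK; exact.
Qed.

(** Each factor is divided by its norm. The norms multiply to the norm of the basis vector, which is
    1, so the tensor product is unchanged. *)
Lemma product_basis_unit (B : vec_family R n) : product_basis B ->
  exists psi : multi_index n -> 'I_n -> 'cV[C]_2,
    forall k, B k = tensor (psi k) /\ forall r, dot (psi k r) (psi k r) = 1.
Proof.
case=> onB B_tensor; suff /fin_all_exists[psi psiE] : forall k,
    exists psi : 'I_n -> 'cV[C]_2,
    B k = tensor psi /\ forall r, dot (psi r) (psi r) = 1 by exists psi.
move=> k; have [phi BE] := B_tensor k.
have dot_ge0 r : 0 <= dot (phi r) (phi r).
  by rewrite /dot addr_ge0 // mulrC mul_conjC_ge0.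
have prod1 : \prod_r dot (phi r) (phi r) = 1.
  by rewrite -inner_tensor -BE onB eqxx.
have dot0 r : sqrtC (dot (phi r) (phi r)) != 0.
  rewrite sqrtC_eq0; have : \prod_r dot (phi r) (phi r) != 0.
    by rewrite prod1 oner_eq0.
  by move/prodf_neq0/(_ r isT).
exists (fun r => (sqrtC (dot (phi r) (phi r)))^-1 *: phi r).
split=> [|r]; last first.
  rewrite dotZ (CrealP _) ?ger0_real ?invr_ge0 ?sqrtC_ge0 //.
  by rewrite -expr2 exprVn sqrtCK mulVf // -sqrtC_eq0.
rewrite tensorZ BE prodfV; apply/ffunP=> l; rewrite [RHS]ffunE.
suff -> : \prod_r sqrtC (dot (phi r) (phi r)) = 1 by rewrite invr1 mul1r.
apply/eqP; rewrite -(@pexpr_eq1 _ _ 2) ?prodr_ge0 // => [|r _]; last first.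
  by rewrite sqrtC_ge0.
by rewrite -prodrXl; under eq_bigr do rewrite sqrtCK; rewrite prod1.
Qed.

Lemma factors_unbiased (m : nat) (T : 'I_m -> vec_family R n) psi :
  MU_product_bases T ->
  (forall i k, T i k = tensor (psi i k) /\
     forall r, dot (psi i k r) (psi i k r) = 1) ->
  forall i j k l r, i != j -> unbiased (psi i k r) (psi j l r).
Proof.
case=> T_basis T_MU psiE i j k l r ij.
apply: (@unbiased_factors (T i) (psi i)) => [|k'|k' r'|r'|k'].
- by have [] := T_basis i.
- by have [] := psiE i k'.
- by have [_ ->] := psiE i k'.
- by have [_ ->] := psiE j l.
by have [<- _] := psiE j l; exact: T_MU.
Qed.

End ProductVectors.

(** * The Pauli triple: unbiasedness and uniqueness *)

Section PauliTriple.
Variables (R : realType) (n : nat).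
Local Notation C := R[i].

Variable e : 'I_3 -> 'I_n -> 'I_2 -> 'cV[C]_2.
Hypothesis e_eigen : pauli_eigenbases e.

Lemma eigenbasis_ortho b r j k : dot (e b r j) (e b r k) = (j == k)%:R.
Proof.
have [/(_ j k) + _] := e_eigen b r.
by rewrite dot_mx => /matrixP/(_ 0 0); rewrite !mxE !mulr1n.
Qed.

Lemma eigenbasis_ray b r j : exists l, same_ray (e b r j) (pauli_vec C b l).
Proof.
have [_ /(_ j)[a ea]] := e_eigen b r.
by apply: eigen_same_ray_pauli ea; rewrite eigenbasis_ortho eqxx.
Qed.

(** By orthogonality the two vectors of [e b r] lie on different rays, so they exhaust both ends of
    the axis. *)
Lemma pauli_vec_ray b r l : exists j, same_ray (pauli_vec C b l) (e b r j).
Proof.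
have [l0 el0] := eigenbasis_ray b r 0; have [l1 el1] := eigenbasis_ray b r 1.
have l01 : l0 != l1.
  apply/eqP=> l01; move: el1; rewrite -l01 => /same_ray_sym.
  case/(same_ray_trans el0) => c c1 e0; have := eigenbasis_ortho b r 1 0.
  rewrite e0 -[X in dot X]scale1r dotZ eigenbasis_ortho eqxx mulr1 conjC1 mul1r.
  by move=> c0; move: c1; rewrite c0 normr0 => /esym/eqP; rewrite oner_eq0.
have [->|ll0] := eqVneq l l0; first by exists 0; apply: same_ray_sym el0.
exists 1; apply: same_ray_sym; rewrite (_ : l = l1) //.
by move: l l0 l1 l01 ll0 {el0 el1}; apply: ord2P; apply: ord2P; apply: ord2P.
Qed.

Lemma unbiased_eigenbases b c r j k :
  b != c -> unbiased (e b r j) (e c r k).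
Proof.
move=> bc; have [l el] := eigenbasis_ray b r j.
have [m em] := eigenbasis_ray c r k.
by apply/(unbiased_ray el em); exact: unbiased_pauli_vec.
Qed.

Lemma pauli_triple_MU : MU_product_bases (pauli_triple e).
Proof.
split=> [b|b c bc]; first split=> [j k|j]; last 2 first.
- by eexists.
- move=> j k; rewrite inner_tensor normr_prod -prodrXl natrX -exprVn.
  rewrite -[n in _ ^+ n]card_ord -prodr_const.
  by apply: eq_bigr => r _; exact: unbiased_eigenbases.
rewrite inner_tensor -prod_nat_eq.
by apply: eq_bigr => r _; rewrite eigenbasis_ortho.
Qed.

(** U is chosen from one vector of each of the first two bases, yet it serves all labels k: any
    factor is unbiased to a vector on each of the other two axes, so it lies on its own axis. *)
Lemma rays_of_triple (psi : 'I_3 -> multi_index n -> 'I_n -> 'cV[C]_2) r :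
  (forall i k, dot (psi i k r) (psi i k r) = 1) ->
  (forall i j k l, i != j -> unbiased (psi i k r) (psi j l r)) ->
  exists2 U : 'M[C]_2, U \is unitarymx &
    forall i k, exists j, same_ray (U *m psi i k r) (e i r j).
Proof.
move=> psi1 psi_unb; pose k0 : multi_index n := [ffun=> 0].
have [U U1 [Uz Ux]] := unitary_to_pauli (psi1 0 k0) (psi1 1 k0)
  (psi_unb 0 1 k0 k0 isT).
exists U => // i k; suff [l /same_ray_trans Ul] : exists l,
    same_ray (U *m psi i k r) (pauli_vec C i l).
  by have [j lj] := pauli_vec_ray i r l; exists j; exact: Ul.
have Upsi1 i' k' : dot (U *m psi i' k' r) (U *m psi i' k' r) = 1.
  by rewrite dot_unitary.
have bloch0 b k' l c k'' : b != c ->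
    same_ray (U *m psi b k' r) (pauli_vec C b l) ->
    bloch b (U *m psi c k'' r) = 0.
  move=> bc Ub; apply/(unbiased_pauli _ l (Upsi1 c k'')).
  apply/(unbiased_ray Ub (same_ray_refl _)).
  by rewrite /unbiased dot_unitary //; exact: psi_unb.
(* The y axis comes first: its reference vector is needed to place the remaining vectors of the
   other two bases. *)
have Uy k' : exists l, same_ray (U *m psi 2 k' r) (pauli_vec C 2 l).
  apply: same_ray_pauli => //; apply: ord3P => // _.
    exact: bloch0 Uz.
  exact: bloch0 Ux.
have [l Uy0] := Uy k0.
move: i; apply: ord3P => //; apply: same_ray_pauli => //; apply: ord3P => // _.
- exact: bloch0 Ux.
- exact: bloch0 Uy0.
- exact: bloch0 Uz.
- exact: bloch0 Uy0.
Qed.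

(** Three steps suffice: a local unitary, a phase correction by the inverse of [d] and a relabelling
    by the inverse of [s]. *)
Lemma MU_triple_equivalent (T : 'I_3 -> vec_family R n) :
  MU_product_bases T -> locally_equivalent T (pauli_triple e).
Proof.
move=> T_MU; have [T_basis _] := T_MU.
have [psi psiE] := fin_all_exists (fun i => product_basis_unit (T_basis i)).
have psi_unb := factors_unbiased T_MU psiE.
have psi1 i k r : dot (psi i k r) (psi i k r) = 1 by have [_ ->] := psiE i k.
have /fin_all_exists[U U_rays] r : exists U : 'M[C]_2, U \is unitarymx /\
    forall i k, exists j, same_ray (U *m psi i k r) (e i r j).
  have [Ur ? ?] := rays_of_triple (fun i k => psi1 i k r)
    (fun i j k l => psi_unb i j k l r).
  by exists Ur.
have /fin_all_exists[s sE] i : exists s : multi_index n -> multi_index n,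
    forall k r, same_ray (U r *m psi i k r) (e i r (s k r)).
  suff /fin_all_exists[s sE] : forall k, exists s : multi_index n,
    forall r, same_ray (U r *m psi i k r) (e i r (s r)) by exists s.
  move=> k; have [f fE] := fin_all_exists (fun r => (U_rays r).2 i k).
  by exists [ffun r => f r] => r; rewrite ffunE.
pose c i k r := dot (e i r (s i k r)) (U r *m psi i k r).
have cE i k r : `|c i k r| = 1 /\ U r *m psi i k r = c i k r *: e i r (s i k r).
  by apply: same_ray_dot; rewrite ?eigenbasis_ortho ?eqxx.
clearbody c; pose d i k := \prod_r c i k r.
have d1 i k : `|d i k| = 1.
  by rewrite normr_prod big1 // => r _; have [] := cE i k r.
have d0 i k : d i k != 0 by rewrite -normr_eq0 d1 oner_eq0.
have UT i k : local_op U (T i k) =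
    [ffun l => d i k * pauli_triple e i (s i k) l].
  have [-> _] := psiE i k; rewrite local_op_tensor -tensorZ.
  apply/ffunP=> l; rewrite !ffunE.
  by apply: eq_bigr => r _; have [_ ->] := cE i k r.
(* If two distinct labels had the same image, some factor of their vanishing inner product would be
   zero, while all its factors have modulus 1. *)
have s_inj i : injective (s i).
  move=> k l skl; apply/eqP; apply: contraT => kl.
  have [onT _] := T_basis i; have := onT k l; rewrite (negPf kl).
  have [-> _] := psiE i k; have [-> _] := psiE i l; rewrite inner_tensor => /eqP.
  rewrite prodf_seq_eq0 => /hasP[r _] /=.
  have [Ur _] := U_rays r; rewrite -(dot_unitary _ _ Ur).
  have [c1 ->] := cE i k r; have [c1' ->] := cE i l r.
  rewrite dotZ skl eigenbasis_ortho eqxx -normr_eq0 !normrM norm_conjC c1 c1'.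
  by rewrite !mul1r normr1 oner_eq0.
apply: (@rt_trans _ _ _ (fun i k => local_op U (T i k))).
  by apply: rt_step; apply: (@step_unitary _ _ _ _ _ U) => // r; case: (U_rays r).
apply: (@rt_trans _ _ _ (fun i k => pauli_triple e i (s i k))).
  apply: rt_step; apply: (@step_phase _ _ _ _ _ (fun i k => (d i k)^-1)) => i k.
    by rewrite normfV d1 invr1.
  by apply/ffunP=> l; rewrite UT !ffunE mulKf.
(* The current family is the Pauli triple precomposed with [s], hence the inverse permutation. *)
apply: rt_step; apply: (@step_permute _ _ _ _ _ (fun i => (perm (s_inj i))^-1%g)).
by move=> i k; rewrite -[in LHS](permKV (perm (s_inj i)) k) [in LHS]permE.
Qed.

End PauliTriple.

Theorem corollary1 (R : realType) (n : nat) (n_ge1 : (1 <= n)%N) :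
  (exists e : 'I_3 -> 'I_n -> 'I_2 -> 'cV[R[i]]_2, pauli_eigenbases e) /\
  (forall e : 'I_3 -> 'I_n -> 'I_2 -> 'cV[R[i]]_2, pauli_eigenbases e ->
     MU_product_bases (pauli_triple e) /\
     (forall T : 'I_3 -> vec_family R n,
        MU_product_bases T -> locally_equivalent T (pauli_triple e))).
Proof.
split.
  by exists (fun b _ => pauli_vec R[i] b) => b _; exact: pauli_vec_eigenbasis.
move=> e e_eigen; split; first exact: pauli_triple_MU.
exact: MU_triple_equivalent.
Qed.
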